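(* Let $m_1$ be a positive even integer and let $m_2 \geq 1$ be an integer. The $m_1 \times m_2$ rook graph $K_{m_1} \square K_{m_2}$ does not have the PH-property if and only if $m_1 = 2$ and $m_2$ is odd.
   Context: All graphs are finite and simple (no loops or multiple edges); in particular a cycle has at least three vertices. $K_m$ denotes the complete graph on $m$ vertices. The Cartesian product $G \square H$ of two graphs $G$ and $H$ is the graph with vertex set $V(G)\times V(H)$ in which $(u_i,v_j)$ and $(u_k,v_l)$ are adjacent precisely if $u_i=u_k$ and $v_jv_l\in E(H)$, or $u_iu_k\in E(G)$ and $v_j=v_l$. The $m_1\times m_2$ rook graph has as vertices the cells of an $m_1\times m_2$ chessboard, two distinct cells being adjacent when they lie in the same row or in the same column; it is (isomorphic to) $K_{m_1}\square K_{m_2}$. For a graph $G$, let $K_G$ denote the complete graph on the vertex set $V(G)$. A perfect matching of a graph is a set of edges such that every vertex belongs to exactly one of them. A Hamiltonian cycle of a graph is a cycle of it visiting every vertex. For a graph $G$ of even order, a pairing of $G$ is a perfect matching of $K_G$ (its edges need not be edges of $G$). A graph $G$ of even order has the Pairing-Hamiltonian property (PH-property) if for every pairing $M$ of $G$ there exists a Hamiltonian cycle $H$ of $K_G$ with $M\subseteq E(H)$ and $E(H)-M\subseteq E(G)$. *)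

(* Defs.v *)
From mathcomp Require Import all_boot.

Set Implicit Arguments.
Unset Strict Implicit.
Unset Printing Implicit Defensive.

Record sgraph := SGraph {
  vertex : finType;
  adj : rel vertex;
  adj_sym : symmetric adj;
  adj_irr : irreflexive adj
}.

(* Edges are two-element sets of vertices. *)
Definition edges (G : sgraph) : {set {set vertex G}} :=
  [set [set p.1; p.2] | p : vertex G * vertex G & adj p.1 p.2].

Section Complete.
Variable T : finType.

Definition complete_rel : rel T := fun x y => x != y.

Fact complete_sym : symmetric complete_rel.
Proof. by move=> x y; rewrite /complete_rel eq_sym. Qed.

Fact complete_irr : irreflexive complete_rel.
Proof. by move=> x; rewrite /complete_rel eqxx. Qed.

Definition complete_on : sgraph := SGraph complete_sym complete_irr.

End Complete.

Definition complete_graph (m : nat) : sgraph := complete_on 'I_m.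

Section CartesianProduct.
Variables G H : sgraph.

Definition cart_rel : rel (vertex G * vertex H) := fun p q =>
  (p.1 == q.1) && adj p.2 q.2 || adj p.1 q.1 && (p.2 == q.2).

Fact cart_sym : symmetric cart_rel.
Proof.
move=> p q; rewrite /cart_rel (eq_sym q.1) (eq_sym q.2).
by rewrite (adj_sym q.1) (adj_sym q.2).
Qed.

Fact cart_irr : irreflexive cart_rel.
Proof. by move=> p; rewrite /cart_rel !adj_irr andbF. Qed.

Definition cart_prod : sgraph := SGraph cart_sym cart_irr.

End CartesianProduct.

Definition perfect_matching (G : sgraph) (M : {set {set vertex G}}) : Prop :=
  M \subset edges G /\ forall v : vertex G, #|[set e in M | v \in e]| = 1.

Definition cycle_edges (T : finType) (c : seq T) : {set {set T}} :=
  [set [set x; next c x] | x in c].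

(* A Hamiltonian cycle is its edge set: that of some cyclic enumeration of all
   the vertices.  The bound on [size c] is needed because the library's [cycle]
   also accepts the closed walks of length 0 and 2. *)
Definition hamiltonian_cycle (G : sgraph) (H : {set {set vertex G}}) : Prop :=
  exists c : seq (vertex G),
    [/\ 3 <= size c, ucycle (@adj G) c, forall v, v \in c & H = cycle_edges c].

Definition pairing (G : sgraph) (M : {set {set vertex G}}) : Prop :=
  @perfect_matching (complete_on (vertex G)) M.

Definition PH_property (G : sgraph) : Prop :=
  ~~ odd #|vertex G| /\
  forall M : {set {set vertex G}}, pairing M ->
    exists H : {set {set vertex G}},
      [/\ @hamiltonian_cycle (complete_on (vertex G)) H,
          M \subset H & H :\: M \subset edges G].

(* Main.v *)
(* View a pairing as a list of dominoes {x, y}, which may be reordered and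
   turned over.  The required Hamiltonian cycle is a closed chain of all the
   dominoes in which neighbouring ends are adjacent in the graph.  If u and v
   are adjacent, a chain containing {x, y} gives one containing {x, u}, {v, y}
   instead, so two dominoes may be glued along an edge uv; one has to glue
   everything together.
   In the rook graph with m1 >= 4 even, a column with a domino leaving it can be
   glued away completely, so one may assume that every remaining column is full
   and paired within itself.  Two such columns can be glued into a single domino
   inside a fixed row, and so can three such columns; hence all of them can be
   glued into dominoes of one row, unless a single column is left.  A row or a
   column, being a clique, is then glued together at will. *)
Require Import Defs.
From mathcomp Require Import all_boot.

Set Implicit Arguments.
Unset Strict Implicit.
Unset Printing Implicit Defensive.

(** * Lists of dominoes up to reordering and turning over *)

Definition eset (T : finType) (e : T * T) : {set T} := [set e.1; e.2].

Definition verts (T : Type) (L : seq (T * T)) : seq T :=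
  flatten [seq [:: e.1; e.2] | e <- L].

Definition same_pairs (T : finType) (L L' : seq (T * T)) : bool :=
  perm_eq (map (@eset T) L) (map (@eset T) L').

(** Second ends meet first ends cyclically, so a single domino closes up when its own two ends are
    adjacent. *)
Definition necklace (G : sgraph) (L : seq (vertex G * vertex G)) : Prop :=
  exists2 L', same_pairs L' L & cycle (fun e f => adj e.2 f.1) L'.

Lemma eset_eq (T : finType) (x y : T) (f : T * T) :
  eset f = [set x; y] -> f = (x, y) \/ f = (y, x).
Proof.
case: f => a b; rewrite /eset /= => E.
have /set2P ha : a \in [set x; y] by rewrite -E set21.
have /set2P hb : b \in [set x; y] by rewrite -E set22.
have /set2P hx : x \in [set a; b] by rewrite E set21.
have /set2P hy : y \in [set a; b] by rewrite E set22.
by case: ha => ?; case: hb => ?; case: hx => ?; case: hy => ?; subst; auto.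
Qed.

Lemma eset_flip (T : finType) (x y : T) : eset (x, y) = eset (y, x).
Proof. exact: setUC. Qed.

Lemma verts_cons (T : Type) (e : T * T) L :
  verts (e :: L) = [:: e.1, e.2 & verts L].
Proof. by []. Qed.

Lemma verts_cat (T : Type) (L K : seq (T * T)) :
  verts (L ++ K) = verts L ++ verts K.
Proof. by rewrite /verts map_cat flatten_cat. Qed.

Lemma mem_verts (T : eqType) (L : seq (T * T)) x :
  reflect (exists2 e, e \in L & x = e.1 \/ x = e.2) (x \in verts L).
Proof.
apply: (iffP flattenP) => [[s /mapP[e eL ->]]|[e eL xe]].
  by rewrite !inE => /orP[]/eqP ->; exists e => //; [left|right].
exists [:: e.1; e.2]; first by apply/mapP; exists e.
by rewrite !inE; case: xe => ->; rewrite eqxx ?orbT.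
Qed.

Lemma same_cat (T : finType) (L1 L2 K1 K2 : seq (T * T)) :
  same_pairs L1 L2 -> same_pairs K1 K2 -> same_pairs (L1 ++ K1) (L2 ++ K2).
Proof. by move=> h1 h2; rewrite /same_pairs !map_cat perm_cat. Qed.

Lemma perm_same (T : finType) (L L' : seq (T * T)) :
  perm_eq L L' -> same_pairs L L'.
Proof. exact: perm_map. Qed.

Lemma same_catCA (T : finType) (L1 L2 L3 : seq (T * T)) :
  same_pairs (L1 ++ L2 ++ L3) (L2 ++ L1 ++ L3).
Proof. by apply: perm_same; rewrite perm_catCA. Qed.

Lemma same_flip (T : finType) (x y : T) L :
  same_pairs ((x, y) :: L) ((y, x) :: L).
Proof. by rewrite /same_pairs /= eset_flip. Qed.

Lemma same_verts (T : finType) (L L' : seq (T * T)) :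
  same_pairs L L' -> perm_eq (verts L) (verts L').
Proof.
move=> h; apply/allP => x _ /=; apply/eqP.
(* A degenerate domino [(x, x)] becomes the singleton of [x] and must count twice. *)
pose w (s : {set T}) : nat := if s == [set x] then 2 else x \in s.
have count_w K : count_mem x (verts K) = sumn (map w (map (@eset T) K)).
  elim: K => //= -[a b] K; rewrite addnA => ->; congr (_ + _).
  rewrite /w /eset /= !inE (eq_sym x a) (eq_sym x b).
  have -> : ([set a; b] == [set x]) = (a == x) && (b == x).
    apply/eqP/andP=> [/setP E|[/eqP-> /eqP->]]; last by rewrite setUid.
    by have := E a; have := E b; rewrite !inE !eqxx orbT => <- <-.
  by case: (a == x); case: (b == x).
by rewrite !count_w; apply: perm_sumn; apply: perm_map.
Qed.

Lemma perm_same_trans (T : finType) (L2 L1 L3 : seq (T * T)) :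
  same_pairs L1 L2 -> same_pairs L2 L3 -> same_pairs L1 L3.
Proof. exact: perm_trans. Qed.

Lemma mem_same_extract (T : finType) (L : seq (T * T)) x :
  x \in verts L -> exists y L0, same_pairs L ((x, y) :: L0).
Proof.
case/mem_verts=> -[a b] eL /= xe.
have h := perm_same (perm_to_rem eL).
case: xe => ->; first by exists b, (rem (a, b) L).
by exists a, (rem (a, b) L); apply: perm_same_trans h (same_flip _ _ _).
Qed.

(** * Gluing dominoes *)

Lemma necklace_same (G : sgraph) (L L' : seq (vertex G * vertex G)) :
  same_pairs L L' -> necklace L' -> necklace L.
Proof.
move=> h [K hK cK]; exists K => //; apply: perm_same_trans hK _.
by rewrite /same_pairs perm_sym.
Qed.

(** The chain passes [x], [u], [v], [y] where it passed [x], [y]; the outer ends are unchanged, so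
    the neighbours still fit. *)
Lemma necklace_move (G : sgraph) (x y u v : vertex G) K :
  adj u v -> necklace ((x, y) :: K) -> necklace [:: (x, u), (v, y) & K].
Proof.
move=> uv [L sL cL].
have : eset (x, y) \in map (@eset _) L by rewrite (perm_mem sL) inE eqxx.
case/mapP=> f fL /esym/eset_eq ef.
have [n l rL] := rot_to fL.
have {}cL : cycle (fun e f => adj e.2 f.1) (f :: l) by rewrite -rL rot_cycle.
have sl : same_pairs l K.
  have : same_pairs (f :: l) ((x, y) :: K).
    by rewrite -rL; apply: perm_same_trans sL; apply: perm_same; rewrite perm_rot.
  by case: ef => ->; rewrite /same_pairs /= ?(eset_flip y) perm_cons.
have glue (a b c d : vertex G) : adj c d -> f = (a, b) ->
    cycle (fun e f => adj e.2 f.1) [:: (a, c), (d, b) & l].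
  move=> cd Ef; move: cL; rewrite Ef /= cd /=.
  by case: (l) => [|g l'] //=; rewrite !rcons_path.
case: ef => Ef.
- exists [:: (x, u), (v, y) & l]; last exact: glue.
  by rewrite /same_pairs /= !perm_cons.
- exists [:: (y, v), (u, x) & l]; last by apply: glue; rewrite // adj_sym.
  apply/permP=> p; rewrite /= (eset_flip y) (eset_flip u) (permP sl).
  exact: addnCA.
Qed.

Lemma necklace1 (G : sgraph) (x y : vertex G) : adj x y -> necklace [:: (x, y)].
Proof. by move=> xy; exists [:: (x, y)]; rewrite /same_pairs //= adj_sym xy. Qed.

(** The free end travels through the clique: from [u] to the first end of the next domino, then on
    from its other end. The end [x] stays fixed and may lie outside the clique. *)
Lemma necklace_absorb (G : sgraph) (x u : vertex G) A :
  uniq (u :: verts A) -> {in u :: verts A &, forall a b, a != b -> adj a b} ->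
  exists2 w, w \in u :: verts A &
    forall K, necklace ((x, w) :: K) -> necklace ((x, u) :: A ++ K).
Proof.
elim: A u => [|[v w] A IH] u /=; first by exists u; rewrite ?inE.
rewrite !inE /= !negb_or => /and4P[/and3P[uv uw uA] /andP[vw vA] wA UA] cl.
have [||w' w'A IHr] := IH w; first by rewrite /= wA.
  by move=> a b aA bA; apply: cl; rewrite !inE -in_cons ?aA ?bA !orbT.
exists w' => [|K rK]; first by rewrite !inE -in_cons w'A !orbT.
by apply: necklace_move (IHr K rK); apply: cl; rewrite ?inE ?eqxx ?orbT.
Qed.

Lemma necklace_clique (G : sgraph) (L : seq (vertex G * vertex G)) :
  0 < size L -> uniq (verts L) ->
  {in verts L &, forall a b, a != b -> adj a b} -> necklace L.
Proof.
case: L => // -[x u] A _ /= /andP[xA UA] cl.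
have [|w wA] := necklace_absorb x UA.
  by move=> a b aA bA; apply: cl; rewrite inE (aA, bA) orbT.
move/(_ [::]); rewrite cats0; apply; apply: necklace1; apply: cl; rewrite ?inE ?eqxx //.
  by rewrite -in_cons wA orbT.
by apply: contraNneq xA => ->.
Qed.

(** Dominoes [(x, u)], [(y, v)] are glued along the clique edge [uv] into [(x, y)], so only the
    first ends survive, and these may lie anywhere. *)
Lemma necklace_pair_up (G : sgraph) (B : seq (vertex G * vertex G)) :
  ~~ odd (size B) -> uniq (map snd B) ->
  {in map snd B &, forall a b, a != b -> adj a b} ->
  exists2 C, verts C = map fst B & forall K, necklace (C ++ K) -> necklace (B ++ K).
Proof.
have [n] := ubnP (size B); elim: n B => // n IH [|[x u] [|[y v] B]] //=.
  by move=> *; exists [::].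
rewrite !ltnS negbK => sB oB /andP[]; rewrite inE negb_or => /andP[uv uB] /andP[vB UB] cl.
have [||||C vC rC] := IH B => //; first exact: ltnW.
  by move=> a b aB bB; apply: cl; rewrite !inE (aB, bB) !orbT.
exists ((x, y) :: C) => [|K rK]; first by rewrite /= -vC.
apply: (@necklace_same _ _ [:: (x, u), (v, y) & B ++ K]).
  by rewrite /same_pairs /= (eset_flip y).
apply: necklace_move; first by apply: cl; rewrite ?inE ?eqxx ?orbT.
apply: (necklace_same (same_catCA [:: (x, y)] B K)); apply: rC.
exact: necklace_same (same_catCA C [:: (x, y)] K) rK.
Qed.

Lemma necklace_map (G H : sgraph) (f : vertex G -> vertex H) L :
  (forall x y, adj x y -> adj (f x) (f y)) ->
  necklace L -> necklace [seq (f e.1, f e.2) | e <- L].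
Proof.
move=> fadj [L' sL cL]; exists [seq (f e.1, f e.2) | e <- L'].
  have E K : map (@eset _) [seq (f e.1, f e.2) | e <- K] =
             [seq f @: s | s : {set vertex G} <- map (@eset _) K].
    by rewrite -!map_comp; apply: eq_map => e; rewrite /= /eset imsetU1 imset_set1.
  by rewrite /same_pairs !E; apply: perm_map.
case: L' cL {sL} => //= e L'; rewrite -(map_rcons _ _ e) path_map.
by apply: sub_path => a b /fadj.
Qed.

(** * Rook graphs and lists filling whole columns *)

Definition rook (I J : finType) : sgraph :=
  cart_prod (complete_on I) (complete_on J).

Lemma rook_necklace_same (I J : finType) (L L' : seq ((I * J) * (I * J))) :
  same_pairs L L' -> @necklace (rook I J) L' -> @necklace (rook I J) L.
Proof. exact: (@necklace_same (rook I J)). Qed.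

Lemma rook_adj_col (I J : finType) (x y : vertex (rook I J)) :
  x.2 = y.2 -> x != y -> adj x y.
Proof.
case: x y => [i j] [i' j'] /= ->; rewrite xpair_eqE eqxx andbT => h.
by rewrite /= /cart_rel /= /complete_rel h eqxx orbT.
Qed.

Lemma rook_adj_row (I J : finType) (x y : vertex (rook I J)) :
  x.1 = y.1 -> x != y -> adj x y.
Proof.
case: x y => [i j] [i' j'] /= ->; rewrite xpair_eqE eqxx => h.
by rewrite /= /cart_rel /= /complete_rel h eqxx.
Qed.

Definition covers (I J : finType) (L : seq ((I * J) * (I * J))) (js : seq J) :=
  uniq (verts L) /\ forall x, (x \in verts L) = (x.2 \in js).

Definition vertical (I J : finType) (L : seq ((I * J) * (I * J))) :=
  all (fun e => e.1.2 == e.2.2) L.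

Lemma vertical_split (I J : finType) (L : seq ((I * J) * (I * J))) j js :
  vertical L -> covers L (j :: js) -> j \notin js ->
  exists C L', [/\ same_pairs L (C ++ L'), covers C [:: j], covers L' js
                 & vertical L'].
Proof.
move=> vL [uL cL] jjs; pose a (e : (I * J) * (I * J)) := e.1.2 == j.
have sL : same_pairs L (filter a L ++ filter (predC a) L).
  by apply: perm_same; rewrite perm_sym perm_filterC.
have := uL; rewrite (perm_uniq (same_verts sL)) verts_cat cat_uniq.
case/and3P=> uC _ uL'.
(* Both ends of a vertical domino lie in the same column, so filtering by the first end selects
   whole columns. *)
have memf (b : pred J) x : (x \in verts [seq e <- L | b e.1.2]) =
    (x \in verts L) && b x.2.
  apply/mem_verts/andP => [[e]|[/mem_verts[e eL xe] bx]].
    rewrite mem_filter => /andP[be eL] xe; split.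
      by apply/mem_verts; exists e.
    by have /eqP := allP vL _ eL; case: xe => -> // <-.
  exists e => //; rewrite mem_filter eL andbT.
  by have /eqP := allP vL _ eL; case: xe bx => -> // ? ->.
exists (filter a L), (filter (predC a) L); split => //.
- split=> // x; rewrite (memf (pred1 j)) cL !inE.
  by case: eqP => //=; rewrite andbF.
- split=> // x; rewrite (memf (predC1 j)) cL !inE.
  by case: eqP => //= [->|_]; rewrite ?andbT ?(negbTE jjs).
- by apply/allP=> e; rewrite mem_filter => /andP[_ /(allP vL)].
Qed.

(** * Merging columns paired within themselves *)

Lemma covers_partner (I J : finType) (C : seq ((I * J) * (I * J))) j i :
  covers C [:: j] ->
  exists p C0, p != i /\ same_pairs C (((i, j), (p, j)) :: C0).
Proof.
move=> [uC cC]; have := cC (i, j); rewrite inE eqxx => /mem_same_extract[[p j'] [C0 sC]].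
have vC := same_verts sC.
have := cC (p, j'); rewrite (perm_mem vC) !inE eqxx orbT => /esym/eqP /= ?; subst j'.
exists p, C0; split=> //; move: uC; rewrite (perm_uniq vC) /= inE negb_or.
by case/andP => /andP[]; rewrite xpair_eqE eqxx andbT eq_sym.
Qed.

(** Keep the domino of rows [i] and [p]; the rest of the column, a clique, is absorbed into one
    domino with fixed end [(k, j)]. *)
Lemma necklace_column_shrink (I J : finType) (C C0 : seq ((I * J) * (I * J))) j i p k :
  covers C [:: j] -> same_pairs C (((i, j), (p, j)) :: C0) -> k != i -> k != p ->
  exists w, [/\ w != i, w != p, w != k & forall K,
    @necklace (rook I J) [:: ((i, j), (p, j)), ((k, j), (w, j)) & K] ->
    @necklace (rook I J) (C ++ K)].
Proof.
move=> [uC cC] sC ki kp.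
have : (k, j) \in verts C0.
  have := cC (k, j); rewrite (perm_mem (same_verts sC)) !inE !xpair_eqE eqxx.
  by rewrite !andbT (negPf ki) (negPf kp).
case/mem_same_extract=> q [C1 sC0].
have {C0 sC0}sC : same_pairs C [:: ((i, j), (p, j)), ((k, j), q) & C1].
  by apply: perm_same_trans sC _; rewrite /same_pairs /= perm_cons.
have vC := same_verts sC.
have col x : x \in verts C -> x.2 = j by rewrite cC inE => /eqP.
have sub : {subset q :: verts C1 <= verts C}.
  by move=> x; rewrite (perm_mem vC) !inE => ->; rewrite !orbT.
have := uC; rewrite (perm_uniq vC) [verts _]/= 2!cons_uniq cons_uniq.
case/and4P=> iC1 pC1 kC1 uC1.
have [|[w j'] wC1 rw] := @necklace_absorb (rook I J) (k, j) q C1 uC1.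
  move=> a b /sub/col ea /sub/col eb; apply: rook_adj_col; rewrite ea eb //.
have /= ? := col _ (sub _ wC1); subst j'.
have ne r s : (r, j) \notin s ++ q :: verts C1 -> w != r.
  by apply: contraNneq => <-; rewrite mem_cat wC1 orbT.
exists w; split=> [|||K rK].
- exact: (@ne i [:: _; _] iC1).
- exact: (@ne p [:: _] pC1).
- exact: (@ne k [::] kC1).
apply: (rook_necklace_same (same_cat sC (perm_same (perm_refl K)))) => /=.
apply: (rook_necklace_same (same_catCA [:: _] (((k, j), q) :: C1) K)).
apply: rw; exact: (rook_necklace_same (same_catCA [:: _] [:: _] K)).
Qed.

(** Shrink the column to the row pairs [i p] and [k w], then glue these along the edge between rows
    [p] and [w]. *)
Lemma necklace_column_to (I J : finType) (C C0 : seq ((I * J) * (I * J))) j i p k K :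
  covers C [:: j] -> same_pairs C (((i, j), (p, j)) :: C0) -> k != i -> k != p ->
  @necklace (rook I J) (((i, j), (k, j)) :: K) -> @necklace (rook I J) (C ++ K).
Proof.
move=> cC sC ki kp rK.
have [w [_ wp _]] := necklace_column_shrink cC sC ki kp; apply.
apply: (@rook_necklace_same I J _ [:: ((i, j), (p, j)), ((w, j), (k, j)) & K]).
  by rewrite /same_pairs /= perm_cons eset_flip.
apply: necklace_move rK; apply: rook_adj_col => //.
by rewrite xpair_eqE negb_and eq_sym wp.
Qed.

Lemma avoid3 (I : finType) (a b c : I) : 3 < #|I| ->
  exists x, [/\ x != a, x != b & x != c].
Proof.
move=> I3; have /subsetPn[x _] : ~~ (predT \subset [:: a; b; c]).
  apply: contraTN I3 => /subset_leq_card/leq_trans/(_ (card_size _)).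
  by rewrite -leqNgt.
by rewrite !inE !negb_or => /and3P[]; exists x.
Qed.

Lemma necklace_row_move (I J : finType) (i k : I) (j1 j2 : J) (x y : I * J) K :
  j1 != j2 -> @necklace (rook I J) ((x, y) :: K) ->
  @necklace (rook I J) [:: (x, (k, j1)), ((k, j2), y) & K].
Proof.
by move=> j12; apply: necklace_move; apply: rook_adj_row; rewrite // xpair_eqE eqxx.
Qed.

(** Both columns become dominoes from row [i] to a common row [x], chosen to avoid [i] and its two
    partners; gluing along row [x] leaves a domino of row [i]. *)
Lemma necklace_two_columns (I J : finType) (C1 C2 : seq ((I * J) * (I * J))) i j1 j2 K :
  3 < #|I| -> j1 != j2 -> covers C1 [:: j1] -> covers C2 [:: j2] ->
  @necklace (rook I J) (((i, j1), (i, j2)) :: K) -> @necklace (rook I J) (C1 ++ C2 ++ K).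
Proof.
move=> I3 j12 c1 c2 rK.
have [p1 [D1 [_ s1]]] := covers_partner i c1.
have [p2 [D2 [_ s2]]] := covers_partner i c2.
have [x [xi x1 x2]] := avoid3 i p1 p2 I3.
apply: (necklace_column_to c1 s1 xi x1).
apply: (rook_necklace_same (same_catCA [:: _] _ _)).
apply: (necklace_column_to c2 s2 xi x2) => /=.
apply: (rook_necklace_same (same_flip _ _ _)).
apply: (rook_necklace_same (same_catCA [:: _] [:: _] _)).
exact: necklace_row_move.
Qed.

(* Columns [j1] and [j3] match row [i] with the same row [p], so [j3] can be
   shrunk to the rows [p], [w] of another pair of [j1] and swallowed by [j1]. *)
Lemma necklace_swallow_column (I J : finType) (C1 C3 D1 D3 : seq ((I * J) * (I * J)))
    i p x j1 j3 K :
  j1 != j3 -> x != i -> x != p -> covers C1 [:: j1] -> covers C3 [:: j3] ->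
  same_pairs C1 (((i, j1), (p, j1)) :: D1) ->
  same_pairs C3 (((i, j3), (p, j3)) :: D3) ->
  @necklace (rook I J) (((i, j1), (x, j1)) :: K) -> @necklace (rook I J) (C1 ++ C3 ++ K).
Proof.
move=> j13 xi xp c1 c3 s1 s3 rK.
have [w [wi wp _ rw]] := necklace_column_shrink c1 s1 xi xp; apply: rw.
apply: (rook_necklace_same (same_catCA [:: _; _] _ _)).
apply: (necklace_column_to c3 (perm_same_trans s3 (same_flip _ _ _)) wp wi).
apply: (rook_necklace_same (same_catCA [:: _] [:: _] _)) => /=.
(* Glue along row [p], then, with the pair of rows [x], [w] turned over, along row [w]. *)
apply: necklace_row_move => //.
apply: (@rook_necklace_same I J _ [:: ((i, j1), (w, j3)), ((w, j1), (x, j1)) & K]).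
  by rewrite /same_pairs /= perm_cons eset_flip.
by apply: necklace_row_move => //; rewrite eq_sym.
Qed.

(** After swallowing [j3], column [j1] can still be made to end in any row [x] other than [i] and
    [p], which suffices to join it with [j2] as for two columns. *)
Lemma necklace_three_columns_eq (I J : finType) (C1 C2 C3 D1 D3 : seq ((I * J) * (I * J)))
    i p j1 j2 j3 K :
  3 < #|I| -> j1 != j2 -> j1 != j3 ->
  covers C1 [:: j1] -> covers C2 [:: j2] -> covers C3 [:: j3] ->
  same_pairs C1 (((i, j1), (p, j1)) :: D1) ->
  same_pairs C3 (((i, j3), (p, j3)) :: D3) ->
  @necklace (rook I J) (((i, j1), (i, j2)) :: K) ->
  @necklace (rook I J) (C1 ++ C3 ++ C2 ++ K).
Proof.
move=> I3 j12 j13 c1 c2 c3 s1 s3 rK.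
have [p2 [D2 [_ s2]]] := covers_partner i c2.
have [x [xi xp x2]] := avoid3 i p p2 I3.
apply: (necklace_swallow_column j13 xi xp c1 c3 s1 s3).
apply: (rook_necklace_same (same_catCA [:: _] _ _)).
apply: (necklace_column_to c2 s2 xi x2) => /=.
apply: (rook_necklace_same (same_flip _ _ _)).
apply: (rook_necklace_same (same_catCA [:: _] [:: _] _)).
exact: necklace_row_move.
Qed.

(* If two of the columns match row [i] with the same row, the previous lemma
   applies.  Otherwise the partners [a], [b], [c] of row [i] are distinct and
   the columns can be shrunk to the triangle of pairs [i b], [i c], [b c]. *)
Lemma necklace_three_columns (I J : finType) (C1 C2 C3 : seq ((I * J) * (I * J)))
    i j1 j2 j3 K :
  3 < #|I| -> uniq [:: j1; j2; j3] ->
  covers C1 [:: j1] -> covers C2 [:: j2] -> covers C3 [:: j3] ->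
  exists k l, [/\ k != l, k \in [:: j1; j2; j3], l \in [:: j1; j2; j3] &
    @necklace (rook I J) (((i, k), (i, l)) :: K) ->
    @necklace (rook I J) (C1 ++ C2 ++ C3 ++ K)].
Proof.
move=> I3 uj c1 c2 c3; move: uj; rewrite /= !inE negb_or.
case/and3P=> /andP[j12 j13] j23 _.
have [a [D1 [ai s1]]] := covers_partner i c1.
have [b [D2 [bi s2]]] := covers_partner i c2.
have [c [D3 [ci s3]]] := covers_partner i c3.
have [eab|ab] := eqVneq a b.
  exists j1, j3; rewrite !inE !eqxx !orbT; split=> // rK; subst b.
  exact: (necklace_three_columns_eq I3 j13 j12 c1 c3 c2 s1 s2).
have [eac|ac] := eqVneq a c.
  exists j1, j2; rewrite !inE !eqxx !orbT; split=> // rK; subst c.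
  apply: (rook_necklace_same (same_cat (perm_same (perm_refl C1)) (same_catCA _ _ _))).
  exact: (necklace_three_columns_eq I3 j12 j13 c1 c2 c3 s1 s3).
have [ebc|bc] := eqVneq b c.
  exists j2, j1; rewrite !inE !eqxx !orbT eq_sym; split=> // rK; subst c.
  apply: (rook_necklace_same (same_catCA _ _ _)).
  apply: (rook_necklace_same (same_cat (perm_same (perm_refl C2)) (same_catCA _ _ _))).
  by apply: (necklace_three_columns_eq I3 _ j23 c2 c1 c3 s2 s3); rewrite // eq_sym.
exists j1, j2; rewrite !inE !eqxx !orbT; split=> // rK.
apply: (necklace_column_to c1 s1 bi); first by rewrite eq_sym.
apply: (rook_necklace_same (same_catCA [:: _] _ _)).
apply: (necklace_column_to c2 s2 ci); first by rewrite eq_sym.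
apply: (rook_necklace_same (same_catCA [:: _; _] _ _)).
apply: (necklace_column_to c3 (perm_same_trans s3 (same_flip _ _ _)) bc bi).
(* The dominoes now run through the row pairs [i b], [b c], [c i]; they are glued along row [b],
   then along row [c]. *)
apply: (@rook_necklace_same I J _ [:: ((i, j1), (b, j1)), ((b, j3), (c, j3)),
                           ((c, j2), (i, j2)) & K]).
  rewrite /same_pairs /= (eset_flip (b, j3)) (eset_flip (c, j2)).
  apply/permP=> P /=; rewrite [RHS]addnCA; congr addn; exact: addnCA.
apply: necklace_row_move => //; apply: necklace_row_move; by rewrite // eq_sym.
Qed.

(** [R] collects the dominoes of row [i] left by the columns already merged. Columns go two at a
    time, or all three when three are left, so their number never becomes one; at the end [R] lies
    in a row, a clique. *)
Lemma necklace_vertical (I J : finType) (L R : seq ((I * J) * (I * J))) i js :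
  3 < #|I| -> size js != 1 -> 0 < size (R ++ L) -> uniq js ->
  vertical L -> covers L js -> uniq (verts R) ->
  (forall x, x \in verts R -> x.1 = i /\ x.2 \notin js) ->
  @necklace (rook I J) (R ++ L).
Proof.
move=> I3; have [n] := ubnP (size js); elim: n js L R => // n IH js L R.
have addR (R' : seq ((I * J) * (I * J))) k l (ks : seq J) :
    k != l -> k \notin ks -> l \notin ks -> uniq (verts R') ->
    (forall x, x \in verts R' -> [/\ x.1 = i, x.2 \notin ks, x.2 != k & x.2 != l]) ->
    uniq (verts (((i, k), (i, l)) :: R')) /\
    (forall x, x \in verts (((i, k), (i, l)) :: R') -> x.1 = i /\ x.2 \notin ks).
  move=> kl kks lks uR hR; split=> [|x].
    rewrite /= inE xpair_eqE eqxx negb_or kl uR andbT /=.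
    by apply/andP; split; apply/negP=> /hR[_ _]; rewrite eqxx.
  by rewrite !inE => /or3P[/eqP->|/eqP->|/hR[]].
case: js => [|j1 [|j2 js]] //=.
  move=> _ _ RL _ _ [_ cL] uR hR.
  have L0 : L = [::].
    by case: (L) cL => // e L' /(_ e.1); rewrite /= !inE eqxx.
  move: RL; rewrite L0 cats0 => RL; apply: necklace_clique => // a b /hR[ea _] /hR[eb _].
  by apply: rook_adj_row; rewrite ea eb.
rewrite !ltnS => sjs _ RL; rewrite inE negb_or -andbA => /and4P[j12 j1s j2s ujs].
move=> vL cL uR hR.
have {hR}hR x : x \in verts R -> [/\ x.1 = i, x.2 \notin js, x.2 != j1 & x.2 != j2].
  by case/hR=> ->; rewrite !inE !negb_or => /and3P[].
have [|C1 [L1 [sL c1 cL1 vL1]]] := vertical_split vL cL.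
  by rewrite inE negb_or j12.
have [C2 [L2 [sL1 c2 cL2 vL2]]] := vertical_split vL1 cL1 j2s.
have [/eqP js1|js1] := eqVneq (size js) 1.
  case: js js1 sjs j1s j2s ujs hR cL cL1 cL2 => // j3 [|//] _ n0.
  rewrite !inE => j13 j23 _ hR _ _ cL2.
  have [|k [l [kl kin lin rK]]] := @necklace_three_columns I J C1 C2 L2 i j1 j2 j3 R I3 _ c1 c2 cL2.
    by rewrite /= !inE negb_or j12 j13 j23.
  apply: (rook_necklace_same (L' := C1 ++ C2 ++ L2 ++ R)).
    apply: perm_same_trans (perm_same _) _; first by rewrite perm_catC.
    apply: perm_same_trans (same_cat sL (perm_same (perm_refl R))) _.
    rewrite -catA; apply: (same_cat (perm_same (perm_refl C1))).
    by rewrite catA; apply: (same_cat sL1 (perm_same (perm_refl R))).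
  apply: rK; rewrite -[_ :: R]cats0.
  have hR' x : x \in verts R -> [/\ x.1 = i, x.2 \notin [::], x.2 != k & x.2 != l].
    case/hR; rewrite inE => -> h3 h1 h2; split=> //; apply/eqP => E.
      by move: kin; rewrite -E !inE (negPf h1) (negPf h2) (negPf h3).
    by move: lin; rewrite -E !inE (negPf h1) (negPf h2) (negPf h3).
  have [//|//|uR' hR''] := addR R k l [::] kl _ _ uR hR'.
  by apply: (IH [::]) => //; apply: leq_trans n0.
apply: (rook_necklace_same (L' := C1 ++ C2 ++ R ++ L2)).
  apply: perm_same_trans (same_cat (perm_same (perm_refl R)) sL) _.
  apply: perm_same_trans (same_catCA _ _ _) _.
  apply: (same_cat (perm_same (perm_refl C1))).
  apply: perm_same_trans (same_cat (perm_same (perm_refl R)) sL1) _.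
  exact: same_catCA.
apply: (necklace_two_columns (i := i) I3 j12 c1 c2); rewrite -cat_cons.
have [uR' hR'] := addR R j1 j2 js j12 j1s j2s uR hR.
by apply: (IH js) => //; apply: leq_trans sjs.
Qed.

(** * Clearing a column that has a crossing domino *)

Lemma column_decomposition (I J : finType) (L : seq ((I * J) * (I * J))) j :
  exists A B C, [/\ same_pairs L (A ++ B ++ C), all (fun x => x.2 == j) (verts A),
    all (fun e => (e.1.2 != j) && (e.2.2 == j)) B &
    all (fun x => x.2 != j) (verts C)].
Proof.
elim: L => [|[x y] L [A [B [C [sL hA hB hC]]]]]; first by exists [::], [::], [::].
have sxL : same_pairs ((x, y) :: L) ((x, y) :: A ++ B ++ C).
  by rewrite /same_pairs /= perm_cons.
have sB : same_pairs ((x, y) :: L) (A ++ ((x, y) :: B) ++ C).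
  exact: perm_same_trans sxL (same_catCA [:: _] _ _).
have [xj|xj] := boolP (x.2 == j); have [yj|yj] := boolP (y.2 == j).
- by exists ((x, y) :: A), B, C; rewrite /= xj yj.
(* Turned over, so that the crossing domino has its second end in column [j]. *)
- exists A, ((y, x) :: B), C; rewrite /= xj yj; split=> //.
  apply: perm_same_trans sB _; apply: same_cat (perm_same (perm_refl _)) _.
  exact: same_flip.
- by exists A, ((x, y) :: B), C; rewrite /= xj yj.
- exists A, B, ((x, y) :: C); rewrite /= xj yj; split=> //.
  apply: perm_same_trans sB _; apply: same_cat (perm_same (perm_refl _)) _.
  exact: same_catCA [:: _] B C.
Qed.

Lemma size_verts (T : Type) (L : seq (T * T)) : size (verts L) = (size L).*2.
Proof. by elim: L => //= e L ->; rewrite doubleS. Qed.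

Lemma perm_verts_unzip (T : eqType) (B : seq (T * T)) :
  perm_eq (verts B) (map fst B ++ map snd B).
Proof.
elim: B => //= -[x y] B IH /=; rewrite perm_cons perm_sym.
by rewrite (perm_catCA _ [:: y]) /= perm_cons perm_sym.
Qed.

(* An inside pair meeting a crossing pair leaves a crossing pair, so while the
   column has a crossing pair the inside pairs can be used up; the crossing
   pairs that remain, even in number, are then joined two by two. *)
Lemma necklace_clear_column (I J : finType) (L L0 : seq ((I * J) * (I * J))) x y js :
  ~~ odd #|I| -> covers L js -> same_pairs L ((x, y) :: L0) -> x.2 != y.2 ->
  uniq js ->
  exists C, covers C (rem y.2 js) /\ (@necklace (rook I J) C -> @necklace (rook I J) L).
Proof.
move=> oI [uL cL] sL xy ujs; pose j := y.2.
have [A [B [C [sL0 hA hB hC]]]] := column_decomposition L0 j.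
have {L0 sL0}sL : same_pairs L ((x, y) :: A ++ B ++ C).
  by apply: perm_same_trans sL _; rewrite /same_pairs /= perm_cons.
have vL := same_verts sL;
(* [X] lists the ends outside column [j], [Y] those inside. *)
set X := x :: map fst B ++ verts C; set Y := y :: verts A ++ map snd B.
have pXY : perm_eq (verts L) (X ++ Y).
  apply/permP=> P; rewrite (permP vL) verts_cons !verts_cat /X /Y /= !count_cat /= !count_cat.
  rewrite (permP (perm_verts_unzip B)) count_cat; congr addn.
  by rewrite [RHS]addnCA; congr addn; rewrite [RHS]addnCA; congr addn; exact: addnAC.
move: uL; rewrite (perm_uniq pXY) cat_uniq => /and3P[uX _ uY].
have colX z : z \in X -> z.2 != j.
  rewrite inE mem_cat => /or3P[/eqP->//|/mapP[e eB ->]|/(allP hC)//].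
  by have /andP[] := allP hB _ eB.
have colY z : z \in Y -> z.2 = j.
  rewrite inE mem_cat => /or3P[/eqP->//|/(allP hA)/eqP//|/mapP[e eB ->]].
  by have /andP[_ /eqP] := allP hB _ eB.
have memL z : (z.2 \in js) = (z \in X) || (z \in Y).
  by rewrite -cL (perm_mem pXY) mem_cat.
(* Column [j] is among [js] because it contains [y], so [Y] is the whole column. *)
have sizeY : size Y = #|I|.
  have <- : size [seq (i, j) | i <- enum I] = #|I| by rewrite size_map -cardE.
  apply: perm_size; apply: uniq_perm => // [|z].
    by rewrite map_inj_uniq ?enum_uniq // => a b [].
  apply/idP/mapP => [/colY <-|[i _ ->]]; first by exists z.1; rewrite ?mem_enum -?surjective_pairing.
  have : j \in js by rewrite (memL y) mem_head orbT.
  rewrite (memL (i, j)) => /orP[/colX|//]; by rewrite eqxx.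
have clY : {in Y &, forall a b, a != b -> @adj (rook I J) a b}.
  by move=> a b /colY ea /colY eb; apply: rook_adj_col; rewrite ea eb.
have [||w wA rw] := @necklace_absorb (rook I J) x y A.
- by move: uY; rewrite /Y -cat_cons cat_uniq => /andP[].
- by move=> a b aA bA; apply: clY; rewrite /Y -cat_cons mem_cat (aA, bA).
have sub : {subset map snd ((x, w) :: B) <= Y}.
  move=> z; rewrite /= inE /Y -cat_cons mem_cat => /predU1P[->|->]; first by rewrite wA.
  exact: orbT.
(* [#|I| = 1 + 2 * size A + size B] is even, hence so is the number [size B + 1] of crossing
   dominoes. *)
have [|||D vD rD] := @necklace_pair_up (rook I J) ((x, w) :: B).
- move: oI; rewrite -sizeY /Y /= size_cat -/(verts A) size_verts size_map oddD odd_double.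
  by [].
- move: uY; rewrite /Y -cat_cons cat_uniq => /and3P[_ /hasPn h uB].
  by rewrite map_cons cons_uniq uB andbT; apply/negP=> /h; rewrite /= wA.
- by move=> a b /sub aY /sub bY; apply: clY.
exists (D ++ C); split; last first.
  by move=> rDC; apply: rook_necklace_same sL _; apply: rw; exact: (rD C).
have vDC : verts (D ++ C) = X by rewrite verts_cat vD.
split; first by rewrite vDC.
move=> z; rewrite vDC mem_rem_uniq // [RHS]inE memL.
apply/idP/andP => [zX|[zj /orP[//|/colY E]]]; first by rewrite zX colX.
by rewrite E eqxx in zj.
Qed.

(** Clearing the column of one end of a non-vertical domino keeps the column of the other end, so
    columns never run out. Once all dominoes are vertical, a single column is a clique and several
    columns are merged. *)
Lemma rook_necklace (I J : finType) (L : seq ((I * J) * (I * J))) js :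
  ~~ odd #|I| -> 3 < #|I| -> js != [::] -> uniq js -> covers L js ->
  @necklace (rook I J) L.
Proof.
move=> oI I3; have [n] := ubnP (size js); elim: n js L => // n IH js L sjs js0 ujs cL.
have [vL|/allPn[e eL ne]] := boolP (vertical L).
  have /card_gt0P[i _] : 0 < #|I| by apply: leq_trans I3.
  have L0 : 0 < size L.
    case: js js0 cL {sjs ujs} => // j js _ [_ /(_ (i, j))].
    by rewrite mem_head; case: (L).
  have [/eqP js1|js1] := eqVneq (size js) 1; last first.
    exact: (@necklace_vertical I J L [::] i js).
  case: cL => uL cL; apply: (@necklace_clique (rook I J)) => // a b.
  case: js js1 cL {sjs js0 ujs} => // j [|//] _ cL; rewrite !cL !inE.
  by move=> /eqP ea /eqP eb; apply: rook_adj_col; rewrite ea eb.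
have sL : same_pairs L ((e.1, e.2) :: rem e L).
  by rewrite -surjective_pairing; apply: perm_same; apply: perm_to_rem.
have [C [cC]] := necklace_clear_column oI cL sL ne ujs; apply.
have inL x : x = e.1 \/ x = e.2 -> x.2 \in js.
  by move=> xe; case: (cL) => _ <-; apply/mem_verts; exists e.
have mem1 : e.1.2 \in rem e.2.2 js.
  by rewrite mem_rem_uniq // inE /= ne inL //; left.
apply: (IH _ _ _ _ _ cC); last exact: rem_uniq.
- have := size_rem (inL e.2 (or_intror erefl)) => ->.
  by case: (js) sjs js0.
- by case: (rem _ _) mem1.
Qed.

(** * From closed chains to Hamiltonian cycles *)

Lemma count_verts (T : finType) (L : seq (T * T)) x :
  all (fun e => e.1 != e.2) L ->
  count_mem x (verts L) = count (fun s : {set T} => x \in s) (map (@eset T) L).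
Proof.
elim: L => // -[a b] L IH /andP[/= ab /IH {}IH].
rewrite IH addnA !inE (eq_sym a x) (eq_sym b x); congr addn.
by case: (x =P a) ab => [->|_ _] /=; [move=> /negPf-> | case: (x == b)].
Qed.

Lemma uniq_verts_neq (T : eqType) (L : seq (T * T)) e :
  uniq (verts L) -> e \in L -> e.1 != e.2.
Proof.
elim: L => // f L IH; rewrite verts_cons /= !inE negb_or.
by case/andP=> /andP[nf _] /andP[_ uL] /predU1P[->//|]; apply: IH.
Qed.

Lemma uniq_verts_fst (T : eqType) (L : seq (T * T)) e f :
  uniq (verts L) -> e \in L -> f \in L -> e.1 = f.1 -> e = f.
Proof.
elim: L => // g L IH; rewrite verts_cons /= !inE negb_or.
case/andP=> /andP[_ g1] /andP[_ uL].
have mem1 h : h \in L -> h.1 \in verts L.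
  by move=> hL; apply/mem_verts; exists h => //; left.
case/predU1P=> [->|eL]; case/predU1P=> [->|fL] // E; last exact: IH.
  by rewrite E mem1 in g1.
by rewrite -E mem1 in g1.
Qed.

(** Flattened, the chain alternates between dominoes, run from first to second end, and [r]-steps
    leaving a second end. *)
Lemma path_verts (T : eqType) (r : rel T) (L l : seq (T * T)) f g :
  {subset f :: l <= L} -> path (fun e f => r e.2 f.1) f (rcons l g) ->
  path (fun x y => ((x, y) \in L) || (x \in map snd L) && r x y)
       f.2 (rcons (verts l) g.1).
Proof.
elim: l f => [|h l IH] f sub /=; rewrite (map_f snd (sub f (mem_head _ _))) /=.
  by move=> /andP[-> _]; rewrite orbT.
case/andP=> -> /IH; rewrite -surjective_pairing orbT (sub h) /= ?inE ?eqxx ?orbT //=.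
by apply=> x xl; apply: sub; rewrite inE xl orbT.
Qed.

(** Orienting the edges of a pairing gives a list of dominoes; read end by end, a closed chain of
    them is the vertex sequence of the required cycle. *)
Lemma necklace_PH (G : sgraph) : 2 < #|vertex G| -> ~~ odd #|vertex G| ->
  (forall L : seq (vertex G * vertex G),
     perm_eq (verts L) (enum (vertex G)) -> necklace L) ->
  PH_property G.
Proof.
move=> G3 oG ringG; split=> // M [/subsetP subM covM].
have [L nL LM] : exists2 L, all (fun e => e.1 != e.2) L & map (@eset (vertex G)) L = enum M.
  have : {subset enum M <= edges (complete_on (vertex G))}.
    by move=> e; rewrite mem_enum => /subM.
  elim: (enum M) => [|s S IH] sS; first by exists [::].
  have [|L nL <-] := IH; first by move=> e eS; apply: sS; rewrite inE eS orbT.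
  have /imsetP[p] := sS s (mem_head _ _).
  by rewrite inE => np ->; exists (p :: L) => //=; rewrite nL andbT.
have perm_L : perm_eq (verts L) (enum (vertex G)).
  apply/allP=> x _; apply/eqP; rewrite /= count_verts // LM.
  have -> : count_mem x (enum (vertex G)) = 1.
    by rewrite count_uniq_mem ?enum_uniq ?mem_enum.
  rewrite -(covM x) -size_filter cardE.
  apply: perm_size; apply: uniq_perm => [||s]; rewrite ?enum_uniq //.
    exact: filter_uniq (enum_uniq _).
  by rewrite mem_filter !mem_enum !inE andbC.
have [L' sL cL] := ringG L perm_L.
have vL := perm_trans (same_verts sL) perm_L.
have uL : uniq (verts L') by rewrite (perm_uniq vL) enum_uniq.
have mL e : (e \in M) = (e \in map (@eset _) L').
  by rewrite (perm_mem sL) LM mem_enum.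
pose Q x y := ((x, y) \in L') || (x \in map snd L') && adj x y.
have cQ : cycle Q (verts L').
  suff cQ l : {subset l <= L'} -> cycle (fun e f => adj e.2 f.1) l -> cycle Q (verts l).
    exact: cQ.
  case: l => // f l sub /(path_verts sub) /= ->.
  by rewrite /Q -surjective_pairing sub ?mem_head.
have Qnext x : Q x (next (verts L') x).
  by apply: next_cycle cQ _; rewrite (perm_mem vL) mem_enum.
exists (cycle_edges (verts L')); split.
- exists (verts L'); split=> //.
  + by rewrite (perm_size vL) -cardE.
  + rewrite /ucycle uL andbT; apply: sub_cycle cQ => x y /orP[|/andP[_ xy]].
      exact: uniq_verts_neq uL.
    by apply: contraTneq xy => ->; rewrite adj_irr.
  + by move=> v; rewrite (perm_mem vL) mem_enum.
- apply/subsetP=> e; rewrite mL => /mapP[f fL ->].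
  (* All ends are distinct, so a first end is never a second end, and the step out of it must be its
     domino. *)
  have fnext : next (verts L') f.1 = f.2.
    case/orP: (Qnext f.1) => [nL'|/andP[f2 _]].
      by have /(congr1 snd) := uniq_verts_fst uL nL' fL erefl.
    move: uL; rewrite (perm_uniq (perm_verts_unzip L')) cat_uniq.
    by case/and3P=> _ /hasPn/(_ _ f2)/negP[]; rewrite /= map_f.
  apply/imsetP; exists f.1; last by rewrite fnext.
  by apply/mem_verts; exists f => //; left.
- apply/subsetP=> e; rewrite inE => /andP[eM /imsetP[x _ ee]].
  case/orP: (Qnext x) => [xL|/andP[_ ax]].
    by case/negP: eM; rewrite mL ee; apply/mapP; exists (x, next (verts L') x).
  by apply/imsetP; exists (x, next (verts L') x); rewrite ?inE.
Qed.

(** * Boards with the PH-property *)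

Lemma rook_PH (I J : finType) :
  ~~ odd #|I| -> 3 < #|I| -> 0 < #|J| -> PH_property (rook I J).
Proof.
move=> oI I3 J0; have cIJ : #|vertex (rook I J)| = #|I| * #|J| by exact: card_prod.
apply: necklace_PH; rewrite ?cIJ ?oddM ?(negbTE oI) //.
  by apply: leq_trans (leq_pmulr _ J0); apply: ltnW.
move=> L vL; apply: (@rook_necklace I J L (enum J)) => //.
- by rewrite -size_eq0 -cardE -lt0n.
- exact: enum_uniq.
- split=> [|x]; first by rewrite (perm_uniq vL) enum_uniq.
  by rewrite (perm_mem vL) !mem_enum.
Qed.

(** Transposing the board preserves adjacency, so closed chains carry over. *)
Lemma rook_swap_PH (I J : finType) :
  ~~ odd #|J| -> 3 < #|J| -> 0 < #|I| -> PH_property (rook I J).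
Proof.
move=> oJ J3 I0; have cIJ : #|vertex (rook I J)| = #|I| * #|J| by exact: card_prod.
apply: necklace_PH; rewrite ?cIJ ?oddM ?(negbTE oJ) ?andbF //.
  by apply: leq_trans (leq_pmull _ I0); apply: ltnW.
move=> L vL; pose sw (x : J * I) := (x.2, x.1); pose ws (x : I * J) := (x.2, x.1).
have -> : L = [seq (sw e.1, sw e.2) | e <- [seq (ws e.1, ws e.2) | e <- L]].
  by rewrite -map_comp map_id_in // => -[[a b] [c d]].
apply: (@necklace_map (rook J I) (rook I J) sw).
  case=> [a b] [c d] /=; rewrite /cart_rel /= orbC.
  by rewrite andbC [X in _ || X]andbC.
have vws : verts [seq (ws e.1, ws e.2) | e <- L] = map ws (verts L).
  by elim: (L) => // e L'; rewrite /= !verts_cons /= => ->.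
have wsK : cancel ws sw by case.
apply: (@rook_necklace J I _ (enum I)) => //.
- by rewrite -size_eq0 -cardE -lt0n.
- exact: enum_uniq.
- rewrite /covers vws; split=> [|x].
    by rewrite (map_inj_uniq (can_inj wsK)) (perm_uniq vL) enum_uniq.
  rewrite mem_enum; apply/mapP; exists (sw x); last by case: x.
  by rewrite (perm_mem vL) mem_enum.
Qed.

(** On a 4-cycle the second domino fits in one of its two orientations: if joining [u] to [v] and
    [y] to [x] fails, these pairs are the diagonals, and turning it over uses sides. *)
Lemma rook22_PH : PH_property (rook 'I_2 'I_2).
Proof.
have c4 : #|vertex (rook 'I_2 'I_2)| = 4 by rewrite card_prod !card_ord.
apply: necklace_PH; rewrite ?c4 // => L vL.
have := perm_size vL; rewrite size_verts -cardE c4.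
have := enum_uniq (vertex (rook 'I_2 'I_2)); rewrite -(perm_uniq vL).
case: L {vL} => [|[x u] [|[v y] [|//]]] // uL _.
have [uv|uv] := boolP (adj u v && adj y x).
  by exists [:: (x, u); (v, y)]; [exact: perm_refl | rewrite /= andbT].
exists [:: (x, u); (y, v)].
  by rewrite /same_pairs /= (eset_flip y).
move: uv uL; rewrite /= andbT.
case: x => [[[|[|//]] ?] [[|[|//]] ?]]; case: u => [[[|[|//]] ?] [[|[|//]] ?]];
case: v => [[[|[|//]] ?] [[|[|//]] ?]]; case: y => [[[|[|//]] ?] [[|[|//]] ?]] //.
Qed.

(** * Two rows and an odd number of columns *)

Lemma even_invol (T : finType) (A : {set T}) (f : T -> T) :
  {in A, forall x, [/\ f x \in A, f x != x & f (f x) = x]} -> ~~ odd #|A|.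
Proof.
(* [lo] marks the lower-ranked point of each orbit; [f] maps the marked points of [A] bijectively
   onto the unmarked ones. *)
move=> fA; pose lo x := enum_rank x < enum_rank (f x).
have lof x : x \in A -> lo (f x) = ~~ lo x.
  move=> /fA[fxA fx ffx]; rewrite /lo ffx -leqNgt [RHS]leq_eqVlt.
  by rewrite (inj_eq (@ord_inj _)) (inj_eq enum_rank_inj) (negPf fx).
rewrite -(cardsID [set x | lo x] A).
suff -> : A :\: [set x | lo x] = f @: (A :&: [set x | lo x]).
  rewrite card_in_imset ?addnn ?odd_double //.
  by apply: (@can_in_inj _ _ _ f f) => x; rewrite inE => /andP[/fA[]].
apply/setP=> x; rewrite !inE; apply/andP/imsetP => [[lx xA]|[y]].
  have [fxA _ ffx] := fA x xA; exists (f x) => //.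
  by rewrite !inE fxA lof.
by rewrite !inE => /andP[yA ly] ->; have [fyA _ _] := fA y yA; rewrite lof ?ly.
Qed.

Lemma next_next_neq (T : eqType) (c : seq T) x :
  uniq c -> 2 < size c -> x \in c -> next c (next c x) != x.
Proof.
move=> uc sc xc; have [n c' rc] := rot_to xc.
rewrite -!(next_rot n uc); move: uc sc; rewrite -(rot_uniq n) -(size_rot n) rc.
case: c' {rc} => [|y [|z c']] //= /andP[]; rewrite !inE !negb_or eqxx.
rewrite !(eq_sym x) => /and3P[yx zx _] _ _; by rewrite (negPf yx) eqxx.
Qed.

(* With all columns paired, a cycle leaves each vertex by one edge of its column
   and one edge of its row; the latter match up the cells of a row. *)
Lemma rook2_not_PH (J : finType) : odd #|J| -> ~ PH_property (rook 'I_2 J).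
Proof.
move=> oJ [_ PH]; pose T := vertex (rook 'I_2 J).
(* With two rows, [bar v] is the other cell of the column of [v]. *)
pose bar (v : T) : T := (rev_ord v.1, v.2).
have barK : involutive bar by case=> i j; rewrite /bar /= rev_ordK.
have bar_neq v : bar v != v by case: v => [[[|[|//]] ?] j]; rewrite xpair_eqE.
have row v w : @adj (rook 'I_2 J) v w -> w != bar v -> w.1 = v.1.
  case: v w => i j [i' j'] /orP[/andP[/eqP-> //]|/andP[/= ii' /eqP jj']].
  rewrite /= in jj'; rewrite -jj' xpair_eqE eqxx andbT => /eqP[]; apply: val_inj.
  by move: ii'; case: i i' => [[|[|//]] ?] [[|[|//]] ?].
pose M := [set [set v; bar v] | v : T].
have barM v : [set v; bar v] \in M by exact: imset_f.
have memM v w : [set v; w] \in M -> w = bar v.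
  case/imsetP=> x _ /esym/(@eset_eq T v w (x, bar x))[] E;
    have /= xE := congr1 fst E; have /= <- := congr1 snd E; rewrite -xE //.
have [|H [[c [c3 /andP[cc uc] allc ->]] MH HG]] := PH M.
  split=> [|v].
    apply/subsetP=> _ /imsetP[v _ ->]; apply/imsetP; exists (v, bar v) => //.
    by rewrite inE /= /complete_rel eq_sym.
  apply: etrans (cards1 [set v; bar v]); apply: eq_card => s; rewrite !inE.
  apply/andP/eqP => [[/imsetP[w _ ->]]|->]; last by rewrite barM set21.
  by case/set2P=> ->; rewrite ?barK // setUC.
(* [M] lies in the cycle, so one neighbour of [v] on it is [bar v]. *)
have nx v : (next c v == bar v) || (prev c v == bar v).
  have /(subsetP MH)/imsetP[x xc] := barM v.
  case/(@eset_eq T _ _ (v, bar v)) => [[-> ->]|[-> ->]]; first by rewrite eqxx.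
  by rewrite prev_next // eqxx orbT.
have nrow v : next c v != bar v -> (next c v).1 = v.1.
  move=> nv; apply: (row _ _ _ nv).
  have /(subsetP HG)/imsetP[[x y]] : [set v; next c v] \in cycle_edges c :\: M.
    rewrite inE (imset_f (fun x => [set x; next c x]) (allc v)) andbT.
    by apply: contra nv => /memM ->.
  rewrite inE => xy /esym/(@eset_eq T _ _ (x, y))[] [<- <-] //.
  by rewrite adj_sym.
(* Column edges on both sides of [v] would force a cycle of length two. *)
have prow v : next c v = bar v -> next c (prev c v) = v /\ v != bar (prev c v).
  move=> nv; rewrite next_prev //; split=> //; apply/eqP=> vE.
  have := next_next_neq uc c3 (allc (prev c v)).
  by rewrite next_prev // nv {1}vE barK eqxx.
(* [f v] is the cycle neighbour of [v] other than [bar v]; on row [ord0] it is an involution without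
   fixed points, which makes [#|J|] even. *)
pose f v := if next c v == bar v then prev c v else next c v.
have := @even_invol T [set v | v.1 == ord0] f.
have -> : #|[set v : T | v.1 == ord0]| = #|J|.
  have -> : [set v : T | v.1 == ord0] = setX [set ord0] setT.
    by apply/setP=> v; rewrite !inE andbT.
  by rewrite cardsX cards1 cardsT mul1n.
rewrite oJ => /(_ _)/negP; apply=> // v; rewrite !inE /f.
have nneq w : next c w != w by rewrite eq_sym; apply: (next_cycle cc).
have [nv|nv] := eqVneq (next c v) (bar v) => v0.
  have [npv vb] := prow v nv; split.
  - by rewrite -(nrow (prev c v)) npv.
  - by apply/eqP=> E; have := nneq (prev c v); rewrite npv E eqxx.
  - by rewrite npv (negPf vb).
split=> //; first by rewrite nrow.
have := nx (next c v); rewrite prev_next // => /orP[->//|/eqP vE].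
by case/eqP: nv; rewrite [in RHS]vE barK.
Qed.

Theorem theorem2p1 (m1 m2 : nat) (hm1 : 0 < m1) (hm1e : ~~ odd m1)
    (hm2 : 1 <= m2) :
  ~ PH_property (cart_prod (complete_graph m1) (complete_graph m2)) <->
  m1 = 2 /\ odd m2.
Proof.
split=> [nPH|[-> m2o]]; last first.
  by apply: (@rook2_not_PH 'I_m2); rewrite card_ord.
have [m13|m13] := ltnP 3 m1.
  by case: nPH; apply: (@rook_PH 'I_m1 'I_m2); rewrite card_ord.
have m1E : m1 = 2 by case: m1 m13 hm1 hm1e {nPH} => [|[|[|[|]]]].
split=> //; apply/negPn/negP=> m2e; apply: nPH; rewrite m1E.
(* Two rows and an even [m2]: transpose when [m2] is at least 4; otherwise the board is 2 by 2. *)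
have [m23|m23] := ltnP 3 m2.
  by apply: (@rook_swap_PH 'I_2 'I_m2); rewrite card_ord.
have -> : m2 = 2 by case: m2 m23 hm2 m2e => [|[|[|[|]]]].
exact: rook22_PH.
Qed.
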